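(* Let $n_1,\ldots,n_k$ be positive integers, let $\sigma$ be a permutation of $\{1,\ldots,k\}$, and let $[U_\sigma]$ be a square matrix over $\mathbb{K}$ with $n_1n_2\cdots n_k$ rows and columns. Then $[U_\sigma]$ is a $\sigma$-tensor permutation matrix $n_1\otimes n_2\otimes\cdots\otimes n_k$ if and only if, for all $[\alpha_1]\in\mathcal{M}_{n_1\times 1}(\mathbb{K})$, $[\alpha_2]\in\mathcal{M}_{n_2\times 1}(\mathbb{K})$, ..., $[\alpha_k]\in\mathcal{M}_{n_k\times 1}(\mathbb{K})$, $$[U_\sigma]\cdot([\alpha_1]\otimes[\alpha_2]\otimes\cdots\otimes[\alpha_k])=[\alpha_{\sigma(1)}]\otimes[\alpha_{\sigma(2)}]\otimes\cdots\otimes[\alpha_{\sigma(k)}].$$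
   Context: $\mathbb{K}=\mathbb{R}$ or $\mathbb{C}$; $\mathcal{M}_{m\times n}(\mathbb{K})$ is the set of $m\times n$ matrices. The tensor product of matrices $[A]=(A^i_j)\in\mathcal{M}_{m\times n}(\mathbb{K})$ and $[B]\in\mathcal{M}_{p\times r}(\mathbb{K})$ is the Kronecker product, i.e. the $mp\times nr$ matrix whose $(i,j)$ block is $A^i_j[B]$. For $\mathbb{K}$-vector spaces $\mathcal{E}_1,\ldots,\mathcal{E}_k$, the $\sigma$-tensor permutation operator is the linear operator $U_\sigma:\mathcal{E}_1\otimes\cdots\otimes\mathcal{E}_k\to\mathcal{E}_{\sigma(1)}\otimes\cdots\otimes\mathcal{E}_{\sigma(k)}$ defined by $U_\sigma(x_1\otimes\cdots\otimes x_k)=x_{\sigma(1)}\otimes\cdots\otimes x_{\sigma(k)}$ for all $x_i\in\mathcal{E}_i$. Let $\mathcal{E}_1,\ldots,\mathcal{E}_k$ have dimensions $n_1,\ldots,n_k$, and let $\mathcal{B}_r=(e_{r1},\ldots,e_{rn_r})$ be a basis of $\mathcal{E}_r$. A $\sigma$-tensor permutation matrix $n_1\otimes n_2\otimes\cdots\otimes n_k$ is the matrix of $U_\sigma$ with respect to the pair of bases $(\mathcal{B}_1\otimes\cdots\otimes\mathcal{B}_k,\ \mathcal{B}_{\sigma(1)}\otimes\cdots\otimes\mathcal{B}_{\sigma(k)})$ of the domain and codomain, where a tensor product of ordered bases consists of the tensor products of basis vectors, ordered lexicographically (last index varying fastest). It does not depend on the choice of the bases $\mathcal{B}_r$. *)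

(* Defs.v *)
From mathcomp Require Import all_boot all_order all_algebra all_fingroup.
From mathcomp Require Export reals complex mxtens.

Set Implicit Arguments.
Unset Strict Implicit.
Unset Printing Implicit Defensive.

Import GRing.Theory.
Local Open Scope ring_scope.

Lemma prod_perm k (n : 'I_k -> nat) (s : 'S_k) :
  (\prod_(i < k) n (s i) = \prod_(i < k) n i)%N.
Proof. by rewrite [RHS](reindex_inj (@perm_inj _ s)). Qed.

(* [A 0] *t ([A 1] *t (... *t ([A (k-1)] *t 1%:M))); the factor 1%:M is 1 x 1,
   and the casts only identify the dimension n_0 * (n_1 * ...) with the
   iterated product. For column vectors (n i = 1) the result has
   \prod_(i < k) 1 columns. *)
Fixpoint kron (K : fieldType) (k : nat) :
    forall (m n : 'I_k -> nat), (forall i, 'M[K]_(m i, n i)) ->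
    'M[K]_(\prod_(i < k) m i, \prod_(i < k) n i) :=
  match k return forall (m n : 'I_k -> nat), (forall i, 'M[K]_(m i, n i)) ->
    'M[K]_(\prod_(i < k) m i, \prod_(i < k) n i) with
  | 0 => fun m n _ =>
      castmx (esym (big_ord0 _ _ xpredT m), esym (big_ord0 _ _ xpredT n)) 1%:M
  | k'.+1 => fun m n A =>
      castmx (esym (big_ord_recl k' m), esym (big_ord_recl k' n))
        (A ord0 *t kron (fun i : 'I_k' => A (lift ord0 i)))
  end.

Lemma lex_digit_proof k (n : 'I_k -> nat) (j : 'I_(\prod_(i < k) n i))
    (i : 'I_k) :
  ((j %/ \prod_(l < k | i < l) n l) %% n i < n i)%N.
Proof.
rewrite ltn_mod lt0n; apply/negP => /eqP ni0.
by case: j => j; rewrite (bigD1 i) //= ni0 mul0n.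
Qed.

(* The j-th multi-index, in lexicographic order (last index varying fastest),
   with entries i : 'I_k in 'I_(n i): mixed-radix digits of j. *)
Definition lex_index k (n : 'I_k -> nat) (j : 'I_(\prod_(i < k) n i))
    (i : 'I_k) : 'I_(n i) :=
  Ordinal (lex_digit_proof j i).

Section TensorProduct.
Variable K : fieldType.

(* dfwith x v is the family x with its i-th component replaced by v : E i. *)
Definition multilinear k (E : 'I_k -> vectType K) (W : lmodType K)
    (f : (forall i, E i) -> W) : Prop :=
  forall (x : forall i, E i) (i : 'I_k), linear (fun v : E i => f (dfwith x v)).

(* (T, tau) is a tensor product of the E i, tau x being x_0 (x) ... (x) x_(k-1);
   vector spaces are finite-dimensional here, but W need not be. *)
Definition is_tensor_product k (E : 'I_k -> vectType K) (T : vectType K)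
    (tau : (forall i, E i) -> T) : Prop :=
  multilinear tau /\
  forall (W : lmodType K) (f : (forall i, E i) -> W), multilinear f ->
    exists2 g : {linear T -> W}, (forall x, g (tau x) = f x)
      & forall h : {linear T -> W}, (forall x, h (tau x) = f x) -> h =1 g.

Definition is_tensor_perm_op k (s : 'S_k) (E : 'I_k -> vectType K)
    (T : vectType K) (tau : (forall i, E i) -> T)
    (T' : vectType K) (tau' : (forall i, E (s i)) -> T')
    (U : 'Hom(T, T')) : Prop :=
  forall x : forall i, E i, U (tau x) = tau' (fun i => x (s i)).

Definition tensor_basis k (n : 'I_k -> nat) (E : 'I_k -> vectType K)
    (B : forall r, (n r).-tuple (E r))
    (T : vectType K) (tau : (forall i, E i) -> T) :
    (\prod_(i < k) n i).-tuple T :=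
  [tuple tau (fun i => tnth (B i) (lex_index j i)) | j < \prod_(i < k) n i].

(* Unlike mxof, which acts on row vectors, column j holds the coordinates of
   f b_j. *)
Definition lin_matrix m m' (T T' : vectType K) (b : m.-tuple T)
    (b' : m'.-tuple T') (f : 'Hom(T, T')) : 'M[K]_(m', m) :=
  \matrix_(i, j) coord b' i (f (tnth b j)).

(* The cast identifies the number of rows n_(s 0) * ... * n_(s (k-1)) with
   n_0 * ... * n_(k-1). *)
Definition is_tensor_perm_matrix k (n : 'I_k -> nat) (s : 'S_k)
    (M : 'M[K]_(\prod_(i < k) n i)) : Prop :=
  exists (E : 'I_k -> vectType K) (B : forall r, (n r).-tuple (E r))
    (T : vectType K) (tau : (forall i, E i) -> T)
    (T' : vectType K) (tau' : (forall i, E (s i)) -> T')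
    (U : 'Hom(T, T')),
    [/\ forall r, basis_of fullv (B r),
        is_tensor_product tau, is_tensor_product tau',
        is_tensor_perm_op tau tau' U
      & M = castmx (prod_perm n s, erefl)
              (lin_matrix (tensor_basis B tau)
                 (tensor_basis (fun i => B (s i)) tau') U)].

End TensorProduct.

(* Main.v *)
From HB Require Import structures.
Require Import Defs.
From mathcomp Require Import all_boot all_order all_algebra all_fingroup.
From mathcomp Require boolp.
Set Implicit Arguments.
Unset Strict Implicit.
Unset Printing Implicit Defensive.
Local Open Scope ring_scope.
Import GRing.Theory.

(** Both sides of the equation are multilinear in the columns
    a_0, ..., a_(k-1), so the equation need only be tested on standard basis
    columns ([multilinear_eq_basis]). There, a Kronecker product is again a
    standard basis column, at the position whose lexicographic multi-index is
    the given family of indices ([kron_std_basis]), and multiplying by M reads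
    off a column of M.

    If M is the matrix of U_s in tensor product bases, U_s sends each basis
    tensor to a basis tensor, so M has a 1 where the multi-index of the row is
    the permuted multi-index of the column and 0 elsewhere
    ([tensor_perm_matrixE]). Reading coordinates this way requires the tensor
    products of basis vectors to be independent; [tensor_basis_free] gets this
    from the universal property alone, and so covers every tensor product. The
    resulting entries are those which the equation prescribes on standard basis
    columns, hence the direct implication.

    For the converse, the equation determines M, as Kronecker products of
    columns reach all the standard basis columns ([mulmx_kron_inj]). It
    therefore suffices that some tensor permutation matrix exists, since by the
    direct implication it satisfies the same equation. Existence
    ([tensor_perm_matrix_exists]) holds because the Kronecker product of
    columns is itself a tensor product ([kron_is_tensor_product]). *)

(** * Lexicographic multi-indices *)

Lemma lex_index_ord0 k (n : 'I_k.+1 -> nat) (j : 'I_(\prod_(i < k.+1) n i)) :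
  lex_index j ord0 = (mxtens_unindex (cast_ord (big_ord_recl k n) j)).1.
Proof.
apply: val_inj => /=.
have -> : (\prod_(l < k.+1 | 0 < l) n l = \prod_(i < k) n (lift ord0 i))%N.
  by rewrite big_mkcond big_ord_recl /= mul1n.
rewrite modn_small //.
exact: (mxtens_index_proof1 (cast_ord (big_ord_recl k n) j)).
Qed.

(** The product of the dimensions from i on divides the whole product, so that
    reducing a number modulo the whole product keeps its digit at i: this is how
    [lex_index_lift] drops the leading digit. *)
Lemma dvdn_lex_weight k (n : 'I_k -> nat) (i : 'I_k) :
  (n i * \prod_(l < k | i < l) n l %| \prod_(l < k) n l)%N.
Proof.
rewrite [X in (_ %| X)%N](bigID (fun l : 'I_k => i <= l)%N) /=.
rewrite [X in (_ %| X * _)%N](bigD1 i) //=.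
rewrite [X in (_ * X %| _)%N](eq_bigl (fun l : 'I_k => (i <= l)%N && (l != i))).
  by rewrite -mulnA mulnA dvdn_mulr.
by move=> l; rewrite ltn_neqAle andbC eq_sym.
Qed.

Lemma lex_index_lift k (n : 'I_k.+1 -> nat) (j : 'I_(\prod_(i < k.+1) n i))
    (i : 'I_k) :
  lex_index j (lift ord0 i)
    = lex_index (mxtens_unindex (cast_ord (big_ord_recl k n) j)).2 i.
Proof.
apply: val_inj => /=.
have -> : (\prod_(l < k.+1 | lift ord0 i < l) n l
            = \prod_(l < k | i < l) n (lift ord0 l))%N.
  by rewrite big_mkcond big_ord_recl /= mul1n -big_mkcond.
set Q := (\prod_(l < k | _) _)%N; set P := (\prod_(l < k) _)%N.
have : (n (lift ord0 i) * Q %| P)%N by exact: (dvdn_lex_weight (n \o lift ord0)).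
case/dvdnP => c defP; have [Q0 | Q_gt0] := posnP Q; first by rewrite Q0 !divn0.
have -> : (j %/ Q = j %/ P * c * n (lift ord0 i) + (j %% P) %/ Q)%N.
  by rewrite {1}(divn_eq j P) {2}defP !mulnA divnMDl.
by rewrite modnMDl.
Qed.

Lemma lex_index_inj k (n : 'I_k -> nat) (j l : 'I_(\prod_(i < k) n i)) :
  (forall i, lex_index j i = lex_index l i) -> j = l.
Proof.
elim: k n j l => [|k IHk] n j l eq_jl.
  by apply: (@cast_ord_inj _ _ (big_ord0 _ _ _ _)); rewrite !ord1.
apply: (@cast_ord_inj _ _ (big_ord_recl k n)).
apply: (can_inj (@mxtens_unindexK _ _)).
rewrite [LHS]surjective_pairing [RHS]surjective_pairing -!lex_index_ord0 eq_jl.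
by congr pair; apply: IHk => i; rewrite -!lex_index_lift eq_jl.
Qed.

Lemma lex_index_surj k (n : 'I_k -> nat) (d : forall i, 'I_(n i)) :
  exists j, lex_index j = d.
Proof.
elim: k n d => [|k IHk] n d.
  exists (cast_ord (esym (big_ord0 _ _ xpredT n)) ord0).
  by apply: boolp.functional_extensionality_dep; case.
have [j' defj'] := IHk _ (fun i => d (lift ord0 i)).
exists (cast_ord (esym (big_ord_recl k n)) (mxtens_index (d ord0, j'))).
apply: boolp.functional_extensionality_dep => i.
have [i' -> | ->] := unliftP ord0 i.
  by rewrite lex_index_lift cast_ordKV mxtens_indexK defj'.
by rewrite lex_index_ord0 cast_ordKV mxtens_indexK.
Qed.

Lemma lex_index_eqE k (n : 'I_k -> nat) (j l : 'I_(\prod_(i < k) n i)) :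
  [forall i, lex_index j i == lex_index l i] = (j == l).
Proof.
apply/forallP/eqP => [eq_jl | -> //].
by apply: lex_index_inj => i; apply/eqP.
Qed.

(** * Entries of Kronecker products *)

Section Kronecker.
Variable K : fieldType.

Lemma kronE k (m n : 'I_k -> nat) (A : forall i, 'M[K]_(m i, n i)) j l :
  kron A j l = \prod_(i < k) A i (lex_index j i) (lex_index l i).
Proof.
elim: k m n A j l => [|k IHk] m n A j l.
  by rewrite castmxE [RHS]big_ord0 mxE [X in X == _]ord1 [X in _ == X]ord1.
rewrite castmxE mxE IHk [RHS]big_ord_recl !lex_index_ord0 !esymK.
congr (_ * _).
by apply: eq_bigr => i _; rewrite (lex_index_lift j) (lex_index_lift l).
Qed.

Lemma kron_colE k (n : 'I_k -> nat) (a : forall i, 'cV[K]_(n i)) j l :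
  kron a j l = \prod_(i < k) a i (lex_index j i) ord0.
Proof. by rewrite kronE; apply: eq_bigr => i _; rewrite [lex_index l i]ord1. Qed.

Lemma prod_eq_family k (n : 'I_k -> nat) (d e : forall i, 'I_(n i)) :
  \prod_(i < k) (d i == e i)%:R = [forall i, d i == e i]%:R :> K.
Proof.
have [/forallP eq_de | /forallPn[i ne_de]] := boolP [forall i, d i == e i].
  by rewrite big1 // => i _; rewrite eq_de.
by rewrite (bigD1 i) //= (negPf ne_de) mul0r.
Qed.

End Kronecker.

(** * Multilinear maps *)

Section Multilinear.
Variable K : fieldType.

Lemma linear_span_eq (V : vectType K) (W : lmodType K) m (b : m.-tuple V)
    (phi psi : V -> W) :
    linear phi -> linear psi -> <<b>>%VS = fullv ->
  (forall d, phi (tnth b d) = psi (tnth b d)) -> phi =1 psi.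
Proof.
move=> lphi lpsi bV eq_b v.
pose Lphi : {linear V -> W} := HB.pack phi (GRing.isLinear.Build _ _ _ _ _ lphi).
pose Lpsi : {linear V -> W} := HB.pack psi (GRing.isLinear.Build _ _ _ _ _ lpsi).
have {1 2}-> := @coord_span _ _ _ b v; last by rewrite bV memvf.
rewrite -[LHS]/(Lphi _) -[RHS]/(Lpsi _) !linear_sum.
by apply: eq_bigr => d _; rewrite !linearZ -!tnth_nth /= eq_b.
Qed.

Lemma dfwith_id k (E : 'I_k -> Type) (x : forall i, E i) i : dfwith x (x i) = x.
Proof.
by apply: boolp.functional_extensionality_dep => j; case: dfwithP.
Qed.

(** The slots are released one at a time: once the maps agree on families whose
    slots from m on hold basis vectors, letting slot m vary gives two linear
    maps that agree on a basis. *)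
Lemma multilinear_eq_basis k (E : 'I_k -> vectType K) (W : lmodType K)
    (n : 'I_k -> nat) (B : forall i, (n i).-tuple (E i))
    (f g : (forall i, E i) -> W) :
    (forall i, <<B i>>%VS = fullv) -> multilinear f -> multilinear g ->
    (forall d : forall i, 'I_(n i), f (fun i => tnth (B i) (d i))
                                  = g (fun i => tnth (B i) (d i))) ->
  f =1 g.
Proof.
move=> BE lf lg eq_fg x.
suff: forall m, (m <= k)%N -> forall y : forall i, E i,
    (forall i : 'I_k, (m <= i)%N -> exists d, y i == tnth (B i) d) -> f y = g y.
  by move/(_ k (leqnn k)); apply=> i; rewrite leqNgt ltn_ord.
elim=> [|m IHm] lt_mk y yB.
  (* Equality is stated as a boolean so that the indices can be chosen at once. *)
  have [d defy] : exists d : forall i, 'I_(n i), forall i, y i = tnth (B i) (d i).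
    exists (fun i => xchoose (yB i isT)) => i.
    exact/eqP/(xchooseP (yB i isT)).
  have -> : y = fun i => tnth (B i) (d i).
    exact: boolp.functional_extensionality_dep.
  exact: eq_fg.
pose i0 := Ordinal lt_mk; rewrite -(dfwith_id y i0).
move: (y i0); apply: linear_span_eq (BE i0) _; [exact: lf | exact: lg|].
move=> d; apply: IHm (ltnW lt_mk) _ _ => i.
have [-> _ | ne_i0i le_mi] := eqVneq i i0.
  by exists d; rewrite dfwith_in.
rewrite dfwith_out 1?eq_sym //; apply: yB.
by rewrite ltn_neqAle le_mi andbT eq_sym.
Qed.

Lemma multilinear_comp k (E : 'I_k -> vectType K) (V W : lmodType K)
    (L : V -> W) (f : (forall i, E i) -> V) :
  linear L -> multilinear f -> multilinear (L \o f).
Proof. by move=> lL lf x i a u v; rewrite /= lf lL. Qed.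

Lemma dfwith_linear k (E : 'I_k -> vectType K) (x : forall i, E i) i j
    (c : E j -> K^o) :
  i = j -> linear c -> linear (fun v : E i => c (dfwith x v j)).
Proof.
move=> eq_ij; case: j / eq_ij c => c lc a u v.
by rewrite !dfwith_in lc.
Qed.

(** The injection p covers both the Kronecker product and its version with
    permuted factors: each argument still enters exactly one factor. *)
Lemma multilinear_prod k (E : 'I_k -> vectType K) (p : 'I_k -> 'I_k)
    (c : forall i, E (p i) -> K^o) :
    injective p -> (forall i, linear (c i)) ->
  multilinear (fun x : forall i, E i => \prod_(i < k) c i (x (p i))).
Proof.
move=> inj_p lc x i a u v; pose j := invF inj_p i.
have pj : p j = i by exact: f_invF.
rewrite !(bigD1 j (P := xpredT)) //=.
rewrite (dfwith_linear x (esym pj) (lc j)) mulrDl -scalerAl.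
have out (w : E i) : \prod_(l < k | l != j) c l (dfwith x w (p l))
           = \prod_(l < k | l != j) c l (x (p l)).
  apply: eq_bigr => l ne_lj; rewrite dfwith_out //.
  by apply: contra ne_lj => /eqP; rewrite -{1}pj => /inj_p ->.
by rewrite !out.
Qed.

Lemma kron_multilinear k (n : 'I_k -> nat) (p : 'I_k -> 'I_k) :
    injective p ->
  multilinear (fun a : forall i, 'cV[K]_(n i) => kron (fun i => a (p i))).
Proof.
move=> inj_p a i c u v; apply/matrixP => j l; rewrite !mxE !kron_colE.
pose coef r (w : 'cV[K]_(n (p r))) := w (lex_index j r) ord0.
apply: (@multilinear_prod k (fun i => 'cV[K]_(n i)) p coef inj_p) => r b w w'.
by rewrite /coef !mxE.
Qed.

End Multilinear.

(** * Tensor products and their bases *)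

Section TensorProduct.
Variable K : fieldType.

(** The universal property turns products of coordinate forms into linear forms
    on T, and these are dual to the family. *)
Lemma tensor_basis_free k (n : 'I_k -> nat) (E : 'I_k -> vectType K)
    (B : forall r, (n r).-tuple (E r)) (T : vectType K)
    (tau : (forall i, E i) -> T) :
    is_tensor_product tau -> (forall r, free (B r)) ->
  free (tensor_basis B tau).
Proof.
case=> _ univ frB.
pose f (x : forall i, E i) : 'cV[K]_(\prod_(i < k) n i) :=
  \col_j \prod_(i < k) coord (B i) (lex_index j i) (x i).
have lf : multilinear f.
  move=> x i a u v; apply/colP => j; rewrite !mxE.
  apply: (@multilinear_prod _ k E id
    (fun i => coord (B i) (lex_index j i)) (@inj_id _)) => r b w w'.
  by rewrite linearD linearZ.
have [g gf _] := univ _ f lf.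
have g_dual j l : g (tnth (tensor_basis B tau) j) l ord0 = (l == j)%:R.
  rewrite tnth_mktuple gf mxE -lex_index_eqE -prod_eq_family.
  apply: eq_bigr => i _; rewrite (tnth_nth 0) coord_free //.
  by rewrite eq_sym.
apply/freeP => c c0 j; have := congr1 (fun v => g v j ord0) c0.
rewrite linear_sum summxE linear0 mxE => <-.
under eq_bigr => l _ do rewrite linearZ mxE -tnth_nth g_dual.
rewrite [RHS](big_only1 j) // ?eqxx ?mulr1 // => l ne_lj _.
by rewrite eq_sym (negPf ne_lj) mulr0.
Qed.

Definition std_basis n : n.-tuple 'cV[K]_n := [tuple delta_mx d ord0 | d < n].

Lemma std_basisP n : basis_of fullv (std_basis n).
Proof.
rewrite basisEdim size_tuple dimvf dim_matrix mulr1 leqnn andbT.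
apply/subvP => v _; rewrite [v]matrix_sum_delta memv_suml // => d _.
rewrite big_ord1 memvZ // memv_span //.
by have <- := tnth_mktuple (fun d => delta_mx d ord0 : 'cV[K]_n) d;
  rewrite mem_tnth.
Qed.

Lemma kron_std_basis k (n : 'I_k -> nat) (d : forall i, 'I_(n i)) j l :
  kron (fun i => tnth (std_basis (n i)) (d i)) j l
    = [forall i, lex_index j i == d i]%:R.
Proof.
rewrite kron_colE -prod_eq_family; apply: eq_bigr => i _.
by rewrite tnth_mktuple mxE eqxx andbT.
Qed.

Lemma kron_std_basis_lex k (n : 'I_k -> nat) (j l : 'I_(\prod_(i < k) n i)) q :
  kron (fun i => tnth (std_basis (n i)) (lex_index l i)) j q = (j == l)%:R.
Proof. by rewrite kron_std_basis lex_index_eqE. Qed.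

Lemma prod1_card k : (\prod_(i < k) 1 = 1)%N. Proof. exact: big1_eq. Qed.

(** The number of columns of a Kronecker product of columns is a product of k
    ones, which does not reduce to 1 when k is a variable. *)
Definition prod1_index k : 'I_(\prod_(i < k) 1) :=
  cast_ord (esym (prod1_card k)) ord0.

Lemma prod1_ord k (l : 'I_(\prod_(i < k) 1)) : l = prod1_index k.
Proof. by apply: (@cast_ord_inj _ _ (prod1_card k)); rewrite !ord1. Qed.

Lemma mulmx_kron_std_basis k (n : 'I_k -> nat) m
    (M : 'M[K]_(m, \prod_(i < k) n i)) j l q :
  (M *m kron (fun i => tnth (std_basis (n i)) (lex_index l i))) j q = M j l.
Proof.
rewrite mxE [LHS](big_only1 l) // => [|r ne_rl _].
  by rewrite kron_std_basis_lex eqxx mulr1.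
by rewrite kron_std_basis_lex (negPf ne_rl) mulr0.
Qed.

(** The Kronecker products of standard basis columns are all the standard basis
    columns, so products of columns detect every column of a matrix. *)
Lemma mulmx_kron_inj k (n : 'I_k -> nat) m
    (M N : 'M[K]_(m, \prod_(i < k) n i)) :
  (forall a : forall i, 'cV[K]_(n i), M *m kron a = N *m kron a) -> M = N.
Proof.
move=> eqMN; apply/matrixP => j l.
by rewrite -2!(mulmx_kron_std_basis _ j l (prod1_index k)) eqMN.
Qed.

Lemma sum_kron_std_basis k (n : 'I_k -> nat)
    (v : 'M[K]_(\prod_(i < k) n i, \prod_(i < k) 1)) :
  v = \sum_l v l (prod1_index k)
        *: kron (fun i => tnth (std_basis (n i)) (lex_index l i)).
Proof.
apply/matrixP => j q; rewrite summxE [RHS](big_only1 j) // => [|l ne_lj _].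
  by rewrite mxE kron_std_basis_lex eqxx mulr1 [q]prod1_ord.
by rewrite mxE kron_std_basis_lex eq_sym (negPf ne_lj) mulr0.
Qed.

(** A multilinear map f factors through the linear map that sends each standard
    basis column to the value of f on the matching family of standard basis
    columns; such a map is unique as these columns span. *)
Lemma kron_is_tensor_product k (n : 'I_k -> nat) :
  is_tensor_product (fun a : forall i, 'cV[K]_(n i) => kron a).
Proof.
split=> [|W f lf]; first exact: (@kron_multilinear K _ n id (@inj_id _)).
pose e l := fun i => tnth (std_basis (n i)) (@lex_index k n l i).
pose g (v : 'M[K]_(\prod_(i < k) n i, \prod_(i < k) 1)) : W :=
  \sum_l v l (prod1_index k) *: f (e l).
have lg : linear g.
  move=> a u v; rewrite scaler_sumr -big_split; apply: eq_bigr => l _ /=.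
  by rewrite !mxE scalerDl scalerA.
pose Lg : {linear _ -> W} := HB.pack g (GRing.isLinear.Build _ _ _ _ _ lg).
exists Lg => [|h hf v] /=.
  apply: (multilinear_eq_basis (B := fun i => std_basis (n i))) => //.
  - by move=> i; rewrite (span_basis (std_basisP _)).
  - apply: (multilinear_comp lg).
    exact: (@kron_multilinear K _ n id (@inj_id _)).
  move=> d; have [l defd] := lex_index_surj d.
  rewrite -defd /= /g [LHS](big_only1 l) // => [|j ne_jl _].
    by rewrite kron_std_basis_lex eqxx scale1r.
  by rewrite kron_std_basis_lex (negPf ne_jl) scale0r.
by rewrite {1}[v]sum_kron_std_basis linear_sum; apply: eq_bigr => l _;
  rewrite linearZ hf.
Qed.

End TensorProduct.

(** * Tensor permutation matrices *)

Section PermutationMatrix.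
Variables (K : fieldType) (k : nat) (n : 'I_k -> nat) (s : 'S_k).

Lemma tensor_perm_matrixE (M : 'M[K]_(\prod_(i < k) n i)) :
  is_tensor_perm_matrix s M ->
  forall j l, M j l =
    [forall i, lex_index (cast_ord (esym (prod_perm n s)) j) i
                 == lex_index l (s i)]%:R.
Proof.
case=> E [B] [T] [tau] [T'] [tau'] [U] [basB tpT tpT' permU ->] j l.
rewrite castmxE cast_ord_id mxE tnth_mktuple permU.
(* U_s sends the l-th basis tensor to the l'-th one, where l' has the permuted
   multi-index of l. *)
have [l' defl'] := lex_index_surj (fun i => lex_index l (s i)).
have -> : tau' (fun i => tnth (B (s i)) (lex_index l (s i)))
    = tnth (tensor_basis (fun i => B (s i)) tau') l'.
  by rewrite tnth_mktuple defl'.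
rewrite (tnth_nth 0) coord_free; last first.
  by apply: tensor_basis_free => // r; apply: basis_free (basB _).
rewrite eq_sym -lex_index_eqE; congr (_%:R); congr nat_of_bool.
by apply: eq_forallb => i; rewrite defl'.
Qed.

Lemma tensor_perm_matrix_kron (M : 'M[K]_(\prod_(i < k) n i)) :
  is_tensor_perm_matrix s M ->
  forall a : forall i, 'cV[K]_(n i),
    M *m kron a = castmx (prod_perm n s, erefl) (kron (fun i => a (s i))).
Proof.
move=> permM; pose B i := std_basis K (n i).
apply: (multilinear_eq_basis (B := B)).
- by move=> i; rewrite (span_basis (std_basisP _ _)).
- apply: (@multilinear_comp _ _ _ _ _ (mulmx M)); first exact: linearP.
  exact: (@kron_multilinear K _ n id (@inj_id _)).
- apply: (@multilinear_comp _ _ _ _ _ (castmx (prod_perm n s, erefl))).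
    by move=> a u v; apply/matrixP => j l; rewrite !(castmxE, mxE).
  exact: kron_multilinear (@perm_inj _ s).
move=> d; apply/matrixP => j q; rewrite castmxE.
have [l <-] := lex_index_surj d.
rewrite (kron_std_basis K (fun i => lex_index l (s i))).
by rewrite mulmx_kron_std_basis tensor_perm_matrixE.
Qed.

(** The universal property of the Kronecker product of columns, applied to the
    multilinear map a |-> a_(s 0) (x) ... (x) a_(s (k-1)), yields U_s. *)
Lemma tensor_perm_matrix_exists :
  exists N : 'M[K]_(\prod_(i < k) n i), is_tensor_perm_matrix s N.
Proof.
have [_ univ] := kron_is_tensor_product K n.
have [u u_kron _] := univ _ _ (@kron_multilinear K _ n _ (@perm_inj _ s)).
eexists.
exists (fun i => 'cV[K]_(n i)), (fun i => std_basis K (n i)), _,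
  (fun a => kron a), _, (fun a => kron a), (linfun u); split.
- by move=> r; apply: std_basisP.
- exact: kron_is_tensor_product.
- exact: (kron_is_tensor_product K (fun i => n (s i))).
- by move=> a; rewrite lfunE /= u_kron.
- by [].
Qed.

End PermutationMatrix.

Theorem theorem0p4p1 (R : realType) (K : fieldType)
    (hK : K = (R : fieldType) \/ K = (R[i] : fieldType))
    (k : nat) (n : 'I_k -> nat) (hn : forall i, (0 < n i)%N)
    (s : 'S_k) (M : 'M[K]_(\prod_(i < k) n i)) :
  is_tensor_perm_matrix s M <->
  forall a : forall i, 'cV[K]_(n i),
    M *m kron a = castmx (prod_perm n s, erefl) (kron (fun i => a (s i))).
Proof.
split=> [|Mkron]; first exact: (tensor_perm_matrix_kron (s := s)).
have [N permN] := tensor_perm_matrix_exists K n s.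
suff -> : M = N by [].
by apply: mulmx_kron_inj => a; rewrite Mkron (tensor_perm_matrix_kron permN).
Qed.
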